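(* There is an absolute constant $C>0$ such that for every integer $n\geq 1$ there exists a connected graph $G$ with $n$ vertices and at most $C\cdot n\cdot L(n)$ edges satisfying $b_{\mathsf{fa}}(G)=\lceil\log_2 n\rceil$, i.e., there is a collection of lists $(\ell_v)_{v\in V(G)}$ such that, in the fully-adaptive source-oblivious model, broadcast from every source vertex completes in $\lceil\log_2 n\rceil$ rounds.
   Context: For a positive integer $x$, $L(x)$ denotes the number of consecutive leading 1s in the binary representation of $x-1$ (e.g. $L(12)=1$ since $11=(1011)_2$). Broadcasting in a connected graph $G$: initially only a source vertex $s$ holds a message; time proceeds in synchronous rounds, and in each round every informed vertex may transmit the message to at most one of its neighbors. Fully-adaptive source-oblivious model: each vertex $v$ is assigned a single ordered list $\ell_v=(u_1,\dots,u_k)$ of distinct neighbors of $v$ (independent of the source). Once $v$ is informed, in each subsequent round it sends the message to the first vertex of $\ell_v$ that is not already informed at the start of that round (informed neighbors are skipped); $v$ stops when all vertices in its list are informed. For a family of lists $L=(\ell_v)_{v\in V(G)}$ and a source $s$, $b_{\mathsf{fa}}(G,s,L)$ denotes the number of rounds until all vertices are informed, and $b_{\mathsf{fa}}(G)=\min_L\max_{s\in V(G)} b_{\mathsf{fa}}(G,s,L)$. *)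

(* Defs.v *)
From mathcomp Require Import all_boot.

Set Implicit Arguments.
Unset Strict Implicit.
Unset Printing Implicit Defensive.

(* Most significant digit first; [binary 0 = [:: false]]. *)
Definition binary (m : nat) : seq bool :=
  [seq odd (m %/ 2 ^ i) | i <- rev (iota 0 (trunc_log 2 m).+1)].

(* [find negb] is the index of the first 0, or the number of digits if there is
   none.  At [x = 1] the representation of [x - 1] is a single 0, so the value
   is 0. *)
Definition leading_ones (x : nat) : nat := find negb (binary (x - 1)).

Definition simple_graph (T : finType) (e : rel T) : Prop :=
  symmetric e /\ irreflexive e.

Definition connected_graph (T : finType) (e : rel T) : Prop :=
  0 < #|T| /\ forall x y : T, connect e x y.

Definition edges (T : finType) (e : rel T) : {set {set T}} :=
  [set [set p.1; p.2] | p : T * T & e p.1 p.2].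

Definition list_family (T : finType) (e : rel T) (l : T -> seq T) : Prop :=
  forall v : T, uniq (l v) /\ (forall u : T, u \in l v -> e v u).

Definition target (T : finType) (l : T -> seq T) (A : {set T}) (v : T) :
    option T :=
  ohead [seq u <- l v | u \notin A].

Definition fa_round (T : finType) (l : T -> seq T) (A : {set T}) : {set T} :=
  A :|: [set u | [exists v in A, target l A v == Some u]].

Definition fa_informed (T : finType) (l : T -> seq T) (s : T) (t : nat) :
    {set T} :=
  iter t (fa_round l) [set s].

(* The broadcast times below are relations with a natural number because they
   may be infinite: when the lists do not let the message reach every vertex
   from [s], no [k] satisfies [fa_time l s k]. *)
Definition fa_time (T : finType) (l : T -> seq T) (s : T) (k : nat) : Prop :=
  fa_informed l s k = [set: T] /\
  forall j : nat, fa_informed l s j = [set: T] -> k <= j.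

(* [max_s b_fa(G, s, l) = k]; for an infinite maximum no [k] qualifies. *)
Definition fa_max_time (T : finType) (l : T -> seq T) (k : nat) : Prop :=
  (exists s : T, fa_time l s k) /\
  forall s : T, exists2 j : nat, fa_time l s j & j <= k.

(* [b_fa(G) = k]; families with an infinite maximum do not affect the
   minimum. *)
Definition b_fa (T : finType) (e : rel T) (k : nat) : Prop :=
  (exists2 l : T -> seq T, list_family e l & fa_max_time l k) /\
  forall (l : T -> seq T) (j : nat),
    list_family e l -> fa_max_time l j -> k <= j.

(* Main.v *)
Require Import Defs.
From mathcomp Require Import all_boot zify.

Set Implicit Arguments.
Unset Strict Implicit.
Unset Printing Implicit Defensive.

(** Let [k] be the rounded up logarithm of [n] and [D] the number of leading
    ones plus 1.  The vertices are the first [n] positive integers that are not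
    multiples of [2^D]; they form the binomial tree in which [v] has the
    children [v + 2^j] with [2^j > v], deprived of its root 0 and of the
    branches at [2^D], [2^D.+1], ...  Vertex [v] calls, in increasing order, the
    powers of 2 below [v] and then its children, so that the graph has at most
    [n * D.+1] edges.

    From any source, all vertices below [2^t] are informed after [t] rounds.
    In round [t.+1], a vertex [u] in [[2^t, 2^t.+1)] is called by its parent,
    unless [u = 2^t].  In that case [u] is called by a vertex informed ahead of
    schedule, that is, by some informed [w > 2^t], which plays the part of the
    missing root.  The source is ahead of schedule at the start, and the
    property persists: when [w < 2^t.+1], the parent of [w] skips [w] in round
    [t.+1] and hence informs its next child, which is at least [2^t.+1].

    When [n = 2^k], the vertices are [1, ..., 2^k], and every vertex also calls
    [2^k] at the end of its list; the vertex that skips a call in round [k]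
    reaches it in time. *)

(** * The logarithmic lower bound on broadcast time *)

Lemma subset_fa_round (T : finType) (l : T -> seq T) (A : {set T}) :
  A \subset fa_round l A.
Proof. exact: subsetUl. Qed.

Lemma target_fa_round (T : finType) (l : T -> seq T) (A : {set T}) (v u : T) :
  v \in A -> target l A v = Some u -> u \in fa_round l A.
Proof.
move=> vA tv; rewrite !inE; apply/orP; right.
by apply/existsP; exists v; rewrite vA tv eqxx.
Qed.

(** Newly informed vertices are targets of informed ones, and each informed vertex has at most one
    target. *)
Lemma card_fa_round (T : finType) (l : T -> seq T) (A : {set T}) :
  #|fa_round l A| <= 2 * #|A|.
Proof.
rewrite mul2n -addnn (leq_trans (leq_card_setU _ _)) // leq_add2l.
set B := [set u | _].
have sB : [set Some u | u in B] \subset [set target l A v | v in A].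
  apply/subsetP => _ /imsetP [u uB ->]; move: uB.
  by rewrite inE => /existsP [v /andP [vA /eqP tv]]; apply/imsetP; exists v.
have := leq_trans (subset_leq_card sB) (leq_imset_card _ _).
by rewrite card_imset //; apply: Some_inj.
Qed.

Lemma card_fa_informed (T : finType) (l : T -> seq T) (s : T) (t : nat) :
  #|fa_informed l s t| <= 2 ^ t.
Proof.
elim: t => [|t IH]; first by rewrite /fa_informed /= cards1.
rewrite /fa_informed iterS expnS (leq_trans (card_fa_round _ _)) //.
by rewrite leq_mul2l.
Qed.

Lemma up_log_fa_informed (T : finType) (l : T -> seq T) (s : T) (t : nat) :
  fa_informed l s t = [set: T] -> up_log 2 #|T| <= t.
Proof.
move=> st; apply: up_log_min => //.
by rewrite -cardsT -st card_fa_informed.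
Qed.

Lemma fa_informed_connect (T : finType) (e : rel T) (l : T -> seq T)
    (s : T) (t : nat) (x : T) :
  list_family e l -> x \in fa_informed l s t -> connect e s x.
Proof.
move=> el; elim: t x => [|t IH] x; first by rewrite inE => /eqP ->.
rewrite /fa_informed iterS inE => /orP [/IH //|].
rewrite inE => /existsP [v /andP [/IH sv]].
rewrite /target; case E: [seq _ <- _ | _] => [//|y r] /eqP [yx].
have : x \in [seq u <- l v | u \notin fa_informed l s t].
  by rewrite E yx mem_head.
rewrite mem_filter => /andP [_ xv].
by apply: connect_trans sv (connect1 _); apply: (el v).2.
Qed.

(** Doubling makes the logarithm a lower bound for all list families, so one family attaining it
    from every source is enough. Calls follow edges, whence connectedness. *)
Lemma b_fa_up_log (T : finType) (e : rel T) (l : T -> seq T) :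
  0 < #|T| -> list_family e l ->
  (forall s, fa_informed l s (up_log 2 #|T|) = [set: T]) ->
  connected_graph e /\ b_fa e (up_log 2 #|T|).
Proof.
move=> T0 el lT.
have lt s : fa_time l s (up_log 2 #|T|).
  by split=> // j; apply: up_log_fa_informed.
split; first split=> // x y.
  by apply: (fa_informed_connect (t := up_log 2 #|T|) el); rewrite lT inE.
split; last first.
  by move=> l' j _ [[s [sT _]] _]; apply: up_log_fa_informed sT.
exists l => //; split; last by move=> s; exists (up_log 2 #|T|).
by case/card_gt0P: T0 => s _; exists s.
Qed.

Lemma card_edges_le (T : finType) (e a : rel T) :
  (forall x y, e x y = a x y || a y x) ->
  #|edges e| <= #|[set p : T * T | a p.1 p.2]|.
Proof.
move=> ea; apply: leq_trans (leq_imset_card (fun p => [set p.1; p.2]) _).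
apply/subset_leq_card/subsetP => _ /imsetP [[x y] xy ->]; move: xy.
rewrite inE /= ea => /orP [] xy; apply/imsetP.
  by exists (x, y); rewrite ?inE.
by exists (y, x); rewrite ?inE // setUC.
Qed.

Lemma target_sorted (T : finType) (f : T -> nat) (l : T -> seq T)
    (A : {set T}) (v u : T) :
  injective f -> sorted (relpre f leq) (l v) ->
  u \in l v -> u \notin A -> (forall x, x \in l v -> f x < f u -> x \in A) ->
  target l A v = Some u.
Proof.
move=> f_inj sl ul uA small; rewrite /target.
have tr : transitive (relpre f leq) by move=> x y z; apply: leq_trans.
have := sorted_filter tr (fun x => x \notin A) sl.
have : u \in [seq x <- l v | x \notin A] by rewrite mem_filter uA.
case E: [seq _ <- _ | _] => [//|y r] /= + yr.
have : y \in [seq x <- l v | x \notin A] by rewrite E mem_head.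
rewrite mem_filter => /andP [yA yl].
rewrite inE => /predU1P [-> //|ur].
have yu : f y <= f u by have /allP := order_path_min tr yr; apply.
case: (ltngtP (f y) (f u)) yu => // [yu|/f_inj ->] // _.
by rewrite small in yA.
Qed.

(** * The call graph of a labelled vertex set, and broadcasting in it *)

Section Labelling.

Variables (T : finType) (f : T -> nat) (k E : nat).

Definition pow2 (m : nat) := m == 2 ^ trunc_log 2 m.

(** [2 ^ trunc_log 2 (f u)] is the leading bit of [f u], so the middle clause says that [v] is the
    parent of [u]: its label is [f u] without that bit. *)
Definition calls : rel T := fun v u =>
  [|| pow2 (f u) && (f u < f v), f u == f v + 2 ^ trunc_log 2 (f u)
    | (v != u) && (f u == 2 ^ k)].

Definition call_list (v : T) : seq T := sort (relpre f leq) (enum (calls v)).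

Definition call_graph : rel T := fun x y => calls x y || calls y x.

Hypothesis f_inj : injective f.

(** The outer clauses of [calls] lead to at most [D] vertices, those labelled by powers of 2; the
    middle one lets [u] determine [v], which adds at most one pair per vertex. *)
Lemma card_calls D : (forall x j, f x = 2 ^ j -> j < D) ->
  #|[set p : T * T | calls p.1 p.2]| <= #|T| * D.+1.
Proof.
move=> fD; set H := [set u | pow2 (f u)].
set P := [set p : T * T | f p.2 == f p.1 + 2 ^ trunc_log 2 (f p.2)].
have H_le : #|H| <= D.
  have hD u : u \in H -> trunc_log 2 (f u) < D.
    by rewrite inE => /eqP /fD.
  case: D fD hD => [|D] fD hD.
    by rewrite leqn0 cards_eq0; apply/set0Pn => -[u /hD].
  rewrite -[D.+1]card_ord -cardsT.
  rewrite -(card_in_imset (f := fun u => inord (trunc_log 2 (f u)) : 'I_D.+1)).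
    exact/subset_leq_card/subsetT.
  move=> u v uH vH /(congr1 val); rewrite /= !inordK ?hD // => uv.
  move: uH vH; rewrite !inE => /eqP uE /eqP vE.
  by apply: f_inj; rewrite uE vE uv.
have P_le : #|P| <= #|T|.
  rewrite -(card_in_imset (f := snd)) ?max_card // => -[x u] [y v].
  rewrite !inE /= => /eqP xE /eqP yE uv; subst v; congr (_, _).
  by apply: f_inj; lia.
apply: (@leq_trans #|setX [set: T] H :|: P|).
  apply/subset_leq_card/subsetP => -[x u]; rewrite !inE /= => /or3P [].
  - by case/andP => ->.
  - by move->; rewrite orbT.
  - by case/andP => _ /eqP ->; rewrite /pow2 trunc_expnK // eqxx.
rewrite (leq_trans (leq_card_setU _ _)) // cardsX cardsT mulnSr leq_add //.
by rewrite leq_mul2l H_le orbT.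
Qed.

Hypothesis f_gt0 : forall x, 0 < f x.
Hypothesis f_le : forall x, f x <= 2 ^ k.
(** [E] marks the round from which nobody has to be ahead of schedule: either no power of 2 from
    [2 ^ E] on is a label, or [E = k] and only the label [2 ^ k] can remain. *)
Hypothesis le_Ek : E <= k.
Hypothesis f_full : forall m, 0 < m < 2 ^ E -> exists x, f x = m.
Hypothesis f_pow : forall x j, f x = 2 ^ j -> j < E \/ E = k.
Hypothesis f_parent : forall t u,
  2 ^ t < f u < 2 ^ t.+1 -> exists p, f p = f u - 2 ^ t.

Lemma mem_call_list v u : (u \in call_list v) = calls v u.
Proof. by rewrite mem_sort mem_enum. Qed.

Lemma calls_irr x : ~~ calls x x.
Proof.
rewrite /calls ltnn andbF eqxx /= orbF neq_ltn.
by rewrite -[X in X < _]addn0 ltn_add2l expn_gt0.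
Qed.

Lemma call_list_family : list_family call_graph call_list.
Proof.
move=> v; split; first by rewrite sort_uniq enum_uniq.
by move=> u; rewrite mem_call_list /call_graph => ->.
Qed.

Lemma call_graph_simple : simple_graph call_graph.
Proof.
split; first by move=> x y; rewrite /call_graph orbC.
by move=> x; rewrite /call_graph (negPf (calls_irr x)).
Qed.

Lemma call_list_round (A : {set T}) v u :
  v \in A -> calls v u -> (forall x, calls v x -> f x < f u -> x \in A) ->
  u \in fa_round call_list A.
Proof.
move=> vA vu small.
case: (boolP (u \in A)) => [|uA]; first exact/subsetP/subset_fa_round.
apply: target_fa_round vA _; apply: target_sorted f_inj _ _ uA _.
- by apply: sort_sorted => x y; apply: leq_total.
- by rewrite mem_call_list.
- by move=> x; rewrite mem_call_list; apply: small.
Qed.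

Lemma calls_child v u t : f v < 2 ^ t -> f u = f v + 2 ^ t -> calls v u.
Proof.
move=> vt uE; rewrite /calls (_ : trunc_log 2 (f u) = t).
  by rewrite uE eqxx orbT.
by apply: trunc_log_eq; rewrite // uE expnS; lia.
Qed.

Lemma callsP v u : calls v u ->
  [\/ f u < f v, f u = 2 ^ k
    | exists2 j, f u = f v + 2 ^ j & f v < 2 ^ j].
Proof.
case/or3P => [/andP [_ ?]|/eqP uE|/andP [_ /eqP ?]];
  [by constructor 1| |by constructor 2].
constructor 3; exists (trunc_log 2 (f u)) => //.
have := @trunc_log_ltn 2 (f u) isT; rewrite expnS; lia.
Qed.

(** Used to show that whatever [v] calls before its child at bit [t] is already on time: earlier
    children add a bit [j < t] to a label below [2 ^ j]. *)
Lemma calls_below v u x t :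
  calls v x -> f x < f u -> f v < 2 ^ t -> f u <= f v + 2 ^ t -> f x < 2 ^ t.
Proof.
case/callsP => [| |[j xE vj] xu vt ut]; [lia| by have := f_le u; lia|].
have lt_jt : j < t by rewrite -(@ltn_exp2l 2) //; lia.
by have := leq_pexp2l (isT : 0 < 2) lt_jt; rewrite expnS; lia.
Qed.

Variable s : T.

Definition on_time t :=
  forall x, f x < 2 ^ t -> x \in fa_informed call_list s t.

Definition ahead t :=
  exists2 w, w \in fa_informed call_list s t & 2 ^ t <= f w.

Lemma on_timeS t :
  t < k -> (t < E -> ahead t) -> on_time t -> on_time t.+1.
Proof.
move=> tk hw ot u; rewrite /fa_informed iterS expnS -/(fa_informed _ _ _) => ut.
set A := fa_informed call_list s t.
have [ut'|tu] := ltnP (f u) (2 ^ t).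
  by apply: (subsetP (subset_fa_round _ _)); apply: ot.
have [uE|/eqP uE] := eqVneq (f u) (2 ^ t).
  have {hw}[|w wA tw] := hw; first by case: (f_pow uE) => // ->.
  have [<-|uw] := eqVneq w u; first exact: (subsetP (subset_fa_round _ _)).
  have {}uw : f u < f w.
    by rewrite ltn_neqAle uE tw andbT -uE; apply: contraNneq uw => /f_inj ->.
  apply: call_list_round wA _ _.
    by rewrite /calls /pow2 uw andbT uE trunc_expnK // eqxx.
  by move=> x _; rewrite uE; apply: ot.
have [|p pE] := f_parent (t := t) (u := u); first by rewrite expnS; lia.
have pt : f p < 2 ^ t by lia.
apply: (@call_list_round _ p); first exact: ot.
  by apply: (calls_child pt); lia.
by move=> x /calls_below xc xu; apply: ot; apply: (xc _ _ xu pt); lia.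
Qed.

(* If [w = 2^t + p] was informed too early, then its parent [p] (or [w] itself
   when [p = 0]) has nobody below [2^t.+1] left to call at round [t.+1]. *)
Lemma idle_vertex t : on_time t -> ahead t ->
  ahead t.+1 \/ exists q,
    [/\ q \in fa_informed call_list s t, f q < 2 ^ t.+1
      & forall u x, f u <= f q + 2 ^ t.+1 -> calls q x -> f x < f u ->
          x \in fa_informed call_list s t].
Proof.
move=> ot [w wA tw]; have [wt|wt] := leqP (2 ^ t.+1) (f w).
  by left; exists w => //; apply: (subsetP (subset_fa_round _ _)).
right.
have [wE|/eqP wE] := eqVneq (f w) (2 ^ t).
  exists w; split=> // u x uw wx xu.
  have := calls_below wx xu wt uw; rewrite expnS => xt.
  case/callsP: wx => [| |[j xE wj]]; last by lia.
    by rewrite wE; apply: ot.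
  by have := f_le u; lia.
have [|p pE] := f_parent (t := t) (u := w); first lia.
have pt : f p < 2 ^ t by move: wt; rewrite expnS; lia.
exists p; split; [exact: ot|by rewrite expnS; lia|].
move=> u x up px xu.
have := calls_below px xu; move/(_ t.+1); rewrite expnS in up *.
move=> /(_ _ up) xt; have {}xt : f x < 2 * 2 ^ t by apply: xt; lia.
have [|xt'] := ltnP (f x) (2 ^ t); first exact: ot.
case/callsP: px => [| |[j xE pj]]; [lia|by have := f_le u; lia|].
suff jt : j = t by rewrite (_ : x = w) //; apply: f_inj; subst j; lia.
apply/eqP; rewrite eqn_leq; apply/andP; split.
  by rewrite -ltnS -(@ltn_exp2l 2) // expnS; lia.
rewrite leqNgt; apply/negP => jt.
by have := leq_pexp2l (isT : 0 < 2) jt; rewrite expnS; lia.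
Qed.

Lemma aheadS t : t.+1 < E -> on_time t -> ahead t -> ahead t.+1.
Proof.
move=> tE ot ht; case: (idle_vertex ot ht) => // -[q [qA qt qc]].
(* The idle vertex turns to its next child, whose label is below [2 ^ t.+2 <= 2 ^ E] and hence in
   use. *)
have [|u uE] := f_full (m := f q + 2 ^ t.+1).
  have := leq_pexp2l (isT : 0 < 2) tE; rewrite expnS.
  by have := expn_gt0 2 t.+1; lia.
exists u; last by lia.
apply: (call_list_round qA); first exact: calls_child qt uE.
by move=> x; apply: qc; rewrite uE.
Qed.

Lemma on_time_ahead t : t <= k -> on_time t /\ (t < E -> ahead t).
Proof.
elim: t => [_|t IH tk].
  (* No label is below [2 ^ 0], and the source itself is ahead. *)
  split; first by move=> x; have := f_gt0 x; lia.
  by move=> _; exists s; rewrite ?f_gt0 // /fa_informed inE.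
have [ot ht] := IH (ltnW tk); split; first exact: on_timeS.
by move=> tE; apply: aheadS => //; apply: ht; apply: ltnW.
Qed.

Lemma fa_informed_call_list : fa_informed call_list s k = [set: T].
Proof.
apply/setP => x; rewrite [RHS]inE.
have [|kx] := ltnP (f x) (2 ^ k).
  by have [ok _] := on_time_ahead (leqnn k); apply: ok.
have xE : f x = 2 ^ k by apply/eqP; rewrite eqn_leq f_le.
have eq_Ek : E = k by case: (f_pow xE) => //; lia.
have [k0|k_gt0] := posnP k.
  have -> : x = s; last by rewrite k0 /fa_informed set11.
  by apply: f_inj; have := f_le s; have := f_gt0 s; rewrite xE k0; lia.
have [ot ht] := on_time_ahead (leq_pred k).
have {}ht : ahead k.-1 by apply: ht; lia.
(* A vertex ahead at time [k] can only be [x]; otherwise the idle vertex has only [x] left to call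
   in round [k]. *)
case: (idle_vertex ot ht); rewrite (prednK k_gt0).
  move=> [w wk kw]; suff -> : x = w by [].
  by apply: f_inj; have := f_le w; lia.
move=> [q [qk qlt qc]]; rewrite -(prednK k_gt0).
apply: (call_list_round qk).
  rewrite /calls xE eqxx andbT; apply/or3P; constructor 3.
  by apply: contraTneq qlt => ->; lia.
by move=> y; apply: qc; lia.
Qed.

End Labelling.

(** * Bounds on a number in terms of its leading ones *)

(** The quotient is the number spelled by the first [i] digits; each further digit 1 sends [d] to
    [2 * d + 1]. *)
Lemma binary_leading_ones m i :
  i <= (trunc_log 2 m).+1 ->
  (forall j, j < i -> nth false (binary m) j) ->
  m %/ 2 ^ ((trunc_log 2 m).+1 - i) = 2 ^ i - 1.
Proof.
set K := trunc_log 2 m.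
elim: i => [_ _|i IH iK ones].
  by rewrite subn0 divn_small // trunc_log_ltn.
have := IH (ltnW iK) (fun j ji => ones j (ltnW ji)).
have := ones i (leqnn _).
rewrite /binary (nth_map 0) ?size_rev ?size_iota // nth_rev ?size_iota //.
rewrite nth_iota ?leq_subr ?add0n //; last by rewrite -/K; lia.
rewrite -/K (_ : K.+1 - i = (K.+1 - i.+1).+1); last by lia.
rewrite expnSr divnMA expnS divn2.
set d := m %/ _ => od; have := odd_double_half d; rewrite od -muln2.
by have := expn_gt0 2 i; lia.
Qed.

Lemma size_binary m : size (binary m) = (trunc_log 2 m).+1.
Proof. by rewrite size_map size_rev size_iota. Qed.

Lemma leading_ones_gt0 n : 1 < n -> 0 < leading_ones n.
Proof.
move=> n1; rewrite /leading_ones /binary -[(trunc_log _ _).+1]addn1.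
rewrite iotaD rev_cat /= add0n.
rewrite (_ : _ %/ _ = 1) //; apply/eqP; rewrite eqn_leq.
have m0 : 0 < n - 1 by lia.
rewrite divn_gt0 ?expn_gt0 // trunc_logP // andbT -ltnS ltn_divLR ?expn_gt0 //.
by rewrite -expnS trunc_log_ltn.
Qed.

(** In the second case the upper bound is the number of nonmultiples of [2 ^ L.+1] below
    [2 ^ up_log 2 n], so that enough labels are available. *)
Variant leading_ones_spec (n : nat) : nat -> Prop :=
| LeadingOnesFull : n = 2 ^ up_log 2 n -> leading_ones_spec n (up_log 2 n)
| LeadingOnesPart L : L < up_log 2 n ->
    2 ^ L.+1 - 1 <= n <= (2 ^ L.+1 - 1) * 2 ^ (up_log 2 n - L.+1) ->
    leading_ones_spec n L.

Lemma leading_onesP n : 1 < n -> leading_ones_spec n (leading_ones n).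
Proof.
move=> n1; have kE := up_log_trunc_log (isT : 1 < 2) n1.
rewrite /leading_ones subn1; set m := n.-1 in kE *.
have nm : n = m.+1 by lia.
set L := find negb _.
have LK : L <= up_log 2 n by rewrite kE -size_binary find_size.
have ones j : j < L -> nth false (binary m) j.
  by move=> jL; apply: negbNE; rewrite (before_find _ jL).
have := binary_leading_ones (m := m) (i := L); rewrite -kE => /(_ LK ones) mL.
move: LK; rewrite leq_eqVlt => /predU1P [LE|LK].
  rewrite LE; constructor; move: mL.
  by rewrite LE subnn divn1; have := expn_gt0 2 (up_log 2 n); lia.
constructor=> //; set k := up_log 2 n in LK kE mL *.
have : ~~ nth false (binary m) L.
  by apply: nth_find; rewrite has_find size_binary -kE.
rewrite /binary (nth_map 0) ?size_rev ?size_iota -?kE // nth_rev ?size_iota //.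
rewrite nth_iota ?add0n; last by lia.
move: mL; rewrite (_ : k - L = (k - L.+1).+1); last by lia.
rewrite expnSr divnMA divn2 expnS.
set q := 2 ^ (k - L.+1); have q0 : 0 < q by rewrite expn_gt0.
set d := m %/ q => dL od; have := odd_double_half d.
rewrite (negPf od) -muln2 => dE; have L0 := expn_gt0 2 L.
(* The first [L.+1] digits of [m] are [L] ones followed by a zero. *)
have {}dE : d = 2 * 2 ^ L - 2 by lia.
have dm := leq_divM m q; rewrite -/d in dm.
have md := ltn_ceil m q0; rewrite -/d in md.
have -> : 2 * 2 ^ L - 1 = d.+1 by lia.
rewrite nm md andbT.
nia.
Qed.

(** * Counting nonmultiples *)

Definition nonmultiples (M N : nat) : pred 'I_N := fun i => ~~ (M %| i).

Lemma card_nonmultiples M N : #|@nonmultiples M N| = \sum_(i < N) ~~ (M %| i).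
Proof.
rewrite -sum1_card big_mkcond; apply: eq_bigr => i _.
by rewrite unfold_in /nonmultiples; case: dvdn.
Qed.

Lemma card_nonmultiplesS M N :
  #|@nonmultiples M N.+1| = #|@nonmultiples M N| + ~~ (M %| N).
Proof. by rewrite !card_nonmultiples big_ord_recr. Qed.

Lemma card_nonmultiples_mul M q : 0 < M ->
  #|@nonmultiples M (M * q)| = M.-1 * q.
Proof.
move=> M0; elim: q => [|q IH].
  by rewrite !muln0 card_nonmultiples big_ord0.
rewrite mulnS addnC [RHS]mulnS [RHS]addnC -IH.
(* Within a block of length [M], only the first number is a multiple. *)
have {IH} H j : j < M ->
    #|@nonmultiples M (M * q + j.+1)| = #|@nonmultiples M (M * q)| + j.
  elim: j => [_|j IHj jM].
    by rewrite addn1 card_nonmultiplesS dvdn_mulr // addn0.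
  rewrite addnS card_nonmultiplesS IHj; last by lia.
  by rewrite dvdn_addr ?dvdn_mulr // gtnNdvd // -addnA addn1.
by have := H M.-1; rewrite prednK // => ->.
Qed.

(** A discrete intermediate value argument: the count grows by at most 1 at each step. *)
Lemma ex_card_nonmultiples M n B :
  n <= #|@nonmultiples M B| -> exists2 N, N <= B & #|@nonmultiples M N| = n.
Proof.
elim: B => [|B IH] nB.
  by exists 0 => //; move: nB; rewrite card_nonmultiples big_ord0; lia.
have [/IH [N NB <-]|Bn] := leqP n #|@nonmultiples M B|.
  by exists N => //; apply: leqW.
by exists B.+1 => //; move: nB; rewrite card_nonmultiplesS; case: (~~ _); lia.
Qed.

Lemma card_nonmultiples_small M N : N <= M -> #|@nonmultiples M N| = N.-1.
Proof.
elim: N => [|N IH] NM; first by rewrite card_nonmultiples big_ord0.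
rewrite card_nonmultiplesS IH; last exact: ltnW.
by case: N NM {IH} => [|N] NM; rewrite ?dvdn0 // gtnNdvd // addn1.
Qed.

(** * Choice of the labels and conclusion *)

Lemma nonmultiples_broadcast D N E n :
  0 < n -> #|@nonmultiples (2 ^ D) N| = n -> N <= (2 ^ up_log 2 n).+1 ->
  E <= up_log 2 n -> E <= D -> 2 ^ E <= N -> D <= E \/ E = up_log 2 n ->
  exists (T : finType) (e : rel T),
    [/\ #|T| = n, simple_graph e, connected_graph e, #|edges e| <= n * D.+1
      & b_fa e (up_log 2 n)].
Proof.
set k := up_log 2 n => n0 cardN Nk Ek ED EN DE.
pose T := {i : 'I_N | nonmultiples (2 ^ D) i}.
pose f (x : T) : nat := val (val x).
have cardT : #|{: T}| = n.
  by rewrite card_sig -cardN; apply: eq_card => i; rewrite inE.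
have f_inj : injective f by move=> x y /val_inj /val_inj.
have f_dvd x : ~~ (2 ^ D %| f x) := valP x.
have f_lt x : f x < N by apply: ltn_ord.
have f_gt0 x : 0 < f x by rewrite lt0n; apply: contraNneq (f_dvd x) => ->.
have f_le x : f x <= 2 ^ k by rewrite -ltnS; apply: leq_trans Nk.
have f_ex m : m < N -> ~~ (2 ^ D %| m) -> exists x, f x = m.
  by move=> mN mD; exists (exist _ (Ordinal mN) mD : T).
have f_full m : 0 < m < 2 ^ E -> exists x, f x = m.
  move=> /andP [m0 mE]; apply: f_ex; first exact: leq_trans EN.
  by rewrite gtnNdvd // (leq_trans mE) // leq_pexp2l.
have f_powD x j : f x = 2 ^ j -> j < D.
  move=> xE; rewrite ltnNge; apply: contra (f_dvd x) => Dj.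
  by rewrite xE dvdn_exp2l.
have f_pow x j : f x = 2 ^ j -> j < E \/ E = k.
  by move=> /f_powD jD; case: DE => ?; [left; apply: leq_trans jD _|right].
have f_parent t u : 2 ^ t < f u < 2 ^ t.+1 -> exists p, f p = f u - 2 ^ t.
  move=> /andP [tu ut]; apply: f_ex; first by have := f_lt u; lia.
  (* Removing the leading bit preserves nondivisibility if [2 ^ D] divides that bit; otherwise the
     remainder is positive and below [2 ^ D]. *)
  have [Dt|tD] := leqP D t.
    by rewrite dvdn_subl ?f_dvd ?dvdn_exp2l // ltnW.
  rewrite gtnNdvd ?subn_gt0 //; have := leq_pexp2l (isT : 0 < 2) (ltnW tD).
  by move: ut; rewrite expnS; lia.
have [|||conn bfa] := @b_fa_up_log _ (call_graph f k) (call_list f k).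
- by rewrite cardT.
- exact: call_list_family.
- move=> s; rewrite cardT.
  exact: (fa_informed_call_list f_inj f_gt0 f_le Ek f_full f_pow f_parent).
rewrite cardT in bfa; exists T, (call_graph f k); split=> //.
  exact: call_graph_simple.
rewrite -cardT; apply: leq_trans (card_edges_le (a := calls f k) _) _ => //.
exact: card_calls.
Qed.

Theorem theorem2 :
  exists C : nat, 0 < C /\
    forall n : nat, 1 <= n ->
      exists (T : finType) (e : rel T),
        [/\ #|T| = n,
            simple_graph e,
            connected_graph e,
            #|edges e| <= C * n * leading_ones n
          & b_fa e (up_log 2 n)].
Proof.
exists 3; split=> // n; rewrite leq_eqVlt => /predU1P [<-|n1].
  (* Here [leading_ones 1 = 0], so the graph must be edgeless. *)
  have [|v|s|conn bfa] :=
    @b_fa_up_log unit (fun _ _ => false) (fun _ => [::]); rewrite ?card_unit //.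
    by case: s; apply/setP => -[]; rewrite up_log1 /fa_informed set11 inE.
  rewrite card_unit in bfa.
  exists unit, (fun _ _ => false); split; rewrite ?card_unit //.
  rewrite (_ : edges _ = set0) ?cards0 //; apply/setP => X; rewrite inE.
  by apply/imsetP => -[p]; rewrite inE.
suff [T [e [cT simple conn le_e bfa]]] : exists (T : finType) (e : rel T),
    [/\ #|T| = n, simple_graph e, connected_graph e,
      #|edges e| <= n * (leading_ones n).+2 & b_fa e (up_log 2 n)].
  exists T, e; split=> //; apply: leq_trans le_e _.
  by rewrite [3 * n]mulnC -mulnA leq_mul2l; have := leading_ones_gt0 n1; lia.
have n0 := ltnW n1; case: (leading_onesP n1) => [nE|L Lk /andP [Ln nL]].
  (* Unification sets [D] to [(up_log 2 n).+1] and [N] to [(2 ^ up_log 2 n).+1]: every label from 1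
     to [n] is kept. *)
  apply: (nonmultiples_broadcast (E := up_log 2 n) n0 _ (leqnn _)) => //.
  - rewrite card_nonmultiples_small // expnS -nE; lia.
  - by right.
have [|N] :=
  @ex_card_nonmultiples (2 ^ L.+1) n (2 ^ L.+1 * 2 ^ (up_log 2 n - L.+1)).
  by rewrite card_nonmultiples_mul ?expn_gt0 // -subn1.
rewrite -expnD subnKC // => NB cardN.
apply: (nonmultiples_broadcast (E := L.+1) n0 cardN) => //; first exact: leqW.
(* With [N < 2 ^ L.+1] there would be only [N.-1] labels, fewer than [2 ^ L.+1 - 1 <= n]. *)
- rewrite leqNgt; apply/negP => NL; move: cardN Ln.
  rewrite (card_nonmultiples_small (ltnW NL)); lia.
- by left.
Qed.
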